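(* Let $\mathcal{V}$ be a vector space over a field $\mathbb{F}$, let $\mathcal{D}:\mathcal{V}\to\mathcal{V}$ be a linear endomorphism, and let $$P=(\mathcal{D}+\lambda_0)^{p_0}(\mathcal{D}+\lambda_1)^{p_1}\cdots(\mathcal{D}+\lambda_\ell)^{p_\ell}:\mathcal{V}\to\mathcal{V},$$ with $\lambda_0,\ldots,\lambda_\ell\in\mathbb{F}$ mutually distinct and $p_i\in\mathbb{Z}_{\ge1}$. Fix $f\in\mathcal{V}$. There is a 1-1 relationship between solutions $u\in\mathcal{V}$ of $Pu=f$ and solutions $(u_0,\ldots,u_\ell)\in\bigoplus^{\ell+1}\mathcal{V}$ of the problem $$(\mathcal{D}+\lambda_0)^{p_0}u_0=f,\ \ldots,\ (\mathcal{D}+\lambda_\ell)^{p_\ell}u_\ell=f.$$ More precisely, write $\mathcal{V}_P^f$ for the solution space of $Pu=f$ and $\mathcal{V}_{\lambda_i}^f$ for the solution space of $(\mathcal{D}+\lambda_i)^{p_i}\tilde u=f$, $i=0,\ldots,\ell$. The map $F:\mathcal{V}_P^f\to\times_{i=0}^{\ell}\mathcal{V}_{\lambda_i}^f$ is given by $$u\mapsto\Big(\prod_{j\ne0}(\mathcal{D}+\lambda_j)^{p_j}u,\ \ldots,\ \prod_{j\ne\ell}(\mathcal{D}+\lambda_j)^{p_j}u\Big),$$ with inverse $B:\times_{i=0}^{\ell}\mathcal{V}_{\lambda_i}^f\to\mathcal{V}_P^f$ given by $$(u_0,\ldots,u_\ell)\mapsto\sum_{i=0}^{\ell}N\Big(\prod_{j\ne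 i}(\mathcal{D}+\lambda_j)^{-p_j}_{\lambda_i}\Big)u_i,$$ where all products over $j$ run over $0\le j\le\ell$ with the indicated exclusion.
   Context: For $j\ne i$, $$(\mathcal{D}+\lambda_j)^{-1}_{\lambda_i}:=(\lambda_j-\lambda_i)^{-1}\Big(1+\frac{\mathcal{D}+\lambda_i}{\lambda_i-\lambda_j}+\cdots+\frac{(\mathcal{D}+\lambda_i)^{p_i-1}}{(\lambda_i-\lambda_j)^{p_i-1}}\Big),$$ and $(\mathcal{D}+\lambda_j)^{-p}_{\lambda_i}$ is the $p$-fold composition of this operator. The normalised operator $N\big(\prod_{j\ne i}(\mathcal{D}+\lambda_j)^{-p_j}_{\lambda_i}\big)$ is obtained by formally expanding the product as a linear combination of powers of $(\mathcal{D}+\lambda_i)$ (as a polynomial in the indeterminate $x+\lambda_i$, then substituting $\mathcal{D}$ for $x$) and keeping only the powers $(\mathcal{D}+\lambda_i)^q$ with $0\le q\le p_i-1$. Empty products are the identity. *)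

(* Defs.v *)
From HB Require Import structures.
From mathcomp Require Import all_boot all_order all_algebra.

Set Implicit Arguments.
Unset Strict Implicit.
Unset Printing Implicit Defensive.

Import GRing.Theory.
Local Open Scope ring_scope.

Section Decomposition.

Variables (F : fieldType) (V : lmodType F) (D : {linear V -> V}).
Variables (l : nat) (lam : 'I_l.+1 -> F) (p : 'I_l.+1 -> nat).

Definition shift_op (a : F) (v : V) : V := D v + a *: v.

Definition factor_op (i : 'I_l.+1) : V -> V := iter (p i) (shift_op (lam i)).

Definition P_op : V -> V := \big[comp/idfun]_(i < l.+1) factor_op i.

Definition cofactor_op (i : 'I_l.+1) : V -> V :=
  \big[comp/idfun]_(j < l.+1 | j != i) factor_op j.

(* The operator (D + lam j)^-1_{lam i} as a formal expression: a polynomial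
   in an indeterminate 'X for which D is to be substituted. *)
Definition inv_symbol (i j : 'I_l.+1) : {poly F} :=
  (lam j - lam i)^-1 *:
    \sum_(k < p i) ((lam i - lam j) ^+ k)^-1 *: ('X + (lam i)%:P) ^+ k.

(* Coefficient of ('X + a) ^+ q in the expansion of Q in powers of 'X + a. *)
Definition shifted_coef (a : F) (Q : {poly F}) (q : nat) : F :=
  (Q \Po ('X - a%:P))`_q.

Definition normalised_op (i : 'I_l.+1) (Q : {poly F}) (v : V) : V :=
  \sum_(q < p i) shifted_coef (lam i) Q q *: iter q (shift_op (lam i)) v.

Definition sol_P (f : V) : {pred V} := [pred u | P_op u == f].

Definition sol_factor (f : V) (i : 'I_l.+1) : {pred V} :=
  [pred u | factor_op i u == f].

Definition sol_prod (f : V) : {pred {ffun 'I_l.+1 -> V}} :=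
  [pred u : {ffun 'I_l.+1 -> V} | [forall i, u i \in sol_factor f i]].

Definition F_map (u : V) : {ffun 'I_l.+1 -> V} := [ffun i => cofactor_op i u].

Definition B_map (u : {ffun 'I_l.+1 -> V}) : V :=
  \sum_(i < l.+1)
    normalised_op i (\prod_(j < l.+1 | j != i) inv_symbol i j ^+ p j) (u i).

End Decomposition.

(* Main.v *)
Require Import Defs.
From HB Require Import structures.
From mathcomp Require Import all_boot all_order all_algebra.

Set Implicit Arguments.
Unset Strict Implicit.
Unset Printing Implicit Defensive.

Import GRing.Theory.
Local Open Scope ring_scope.

(** The operators in play are polynomials in [D], so everything takes place in
    the commutative ring [{poly F}] acting on [V].  Put
    [T_i = ('X + lam_i)^p_i], let [R_i] be the product of the [T_j] for
    [j != i], and let [N_i] be the polynomial of the normalised operator of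
    index [i].  Then [F u] has the entries [R_i u], and
    [B u = \sum_i N_i u_i].

    The key fact is the Bezout identity [\sum_i N_i R_i = 1]
    ([cofactor_bezout]).  By a truncated geometric series, the symbol inverting
    [D + lam_j] is an inverse of ['X + lam_j] modulo [T_i], and truncation at
    order [p_i] in powers of ['X + lam_i] does not change a class modulo [T_i];
    hence [N_i R_i] is 1 modulo [T_i].  As [R_i] vanishes modulo [T_k] for
    [k != i], the sum [\sum_i N_i R_i] is 1 modulo every [T_k], hence modulo
    their product because they are pairwise coprime.  Truncation also gives
    [deg N_i < deg T_i], so the degree of the sum is smaller than that of the
    product, and the congruence is an equality.

    The rest is formal.  [B (F u) = \sum_i N_i R_i u = u].  If [T_i u_i = f]
    for all [i], then [P (B u) = \sum_i N_i R_i T_i u_i = \sum_i N_i R_i f = f].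
    Finally, for [i != k], let [S] be the product of the [T_j] with [j]
    different from [i] and [k]; then [R_k u_i = S T_i u_i = S f], which is
    symmetric in [i] and [k] and so equals [R_i u_k].  Therefore
    [R_k (B u) = \sum_i N_i R_k u_i = \sum_i N_i R_i u_k = u_k]. *)

(** * Polynomials in a linear endomorphism *)

Section PolynomialAction.

Variables (F : fieldType) (V : lmodType F) (D : {linear V -> V}).
Implicit Types (v : V) (Q R : {poly F}).

(** The value at [v] of the operator [Q(D)].  The vector comes first so that
    linearity in [Q] can be declared as a canonical structure. *)
Definition op_eval v Q : V := \sum_(k < size Q) Q`_k *: iter k D v.

(** Linearity in [Q] is not visible on the definition because the range of
    summation depends on [Q]; any common bound on the sizes will do. *)
Lemma op_eval_wide n v Q :
  (size Q <= n)%N -> op_eval v Q = \sum_(k < n) Q`_k *: iter k D v.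
Proof.
move=> leQn; rewrite /op_eval.
rewrite (big_ord_widen n (fun k => Q`_k *: iter k D v)) //.
rewrite big_mkcond; apply: eq_bigr => k _.
by case: ltnP => // leQk; rewrite nth_default // scale0r.
Qed.

Lemma op_eval_is_linear v : linear (op_eval v).
Proof.
move=> a Q R; set n := maxn (size Q) (size R).
have leQ : (size Q <= n)%N by rewrite leq_maxl.
have leR : (size R <= n)%N by rewrite leq_maxr.
have leQR : (size (a *: Q + R)%R <= n)%N.
  rewrite (leq_trans (size_polyD _ _)) // geq_max leR andbT.
  exact: leq_trans (size_scale_leq _ _) leQ.
rewrite !(op_eval_wide (n := n)) // scaler_sumr -big_split /=.
by apply: eq_bigr => k _; rewrite coefD coefZ scalerDl scalerA.
Qed.

HB.instance Definition _ v :=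
  GRing.isLinear.Build F {poly F} V _ (op_eval v) (op_eval_is_linear v).

Lemma iter_linear_sum (I : finType) (u : I -> V) k :
  iter k D (\sum_i u i) = \sum_i iter k D (u i).
Proof. by elim: k => //= k ->; rewrite linear_sum. Qed.

Lemma op_eval_sumv (I : finType) (u : I -> V) Q :
  op_eval (\sum_i u i) Q = \sum_i op_eval (u i) Q.
Proof.
rewrite exchange_big /=; apply: eq_bigr => k _.
by rewrite iter_linear_sum scaler_sumr.
Qed.

Lemma op_evalC v c : op_eval v c%:P = c *: v.
Proof.
by rewrite (op_eval_wide (n := 1)) ?size_polyC_leq1 // big_ord1 coefC.
Qed.

Lemma op_eval1 v : op_eval v 1 = v.
Proof. by rewrite op_evalC scale1r. Qed.

Lemma op_evalMX v Q : op_eval v (Q * 'X) = op_eval (D v) Q.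
Proof.
rewrite (op_eval_wide (n := (size Q).+1)); last first.
  by rewrite (leq_trans (size_polyMleq _ _)) // size_polyX addn2.
rewrite big_ord_recl coefMX scale0r add0r; apply: eq_bigr => k _.
by rewrite coefMX /= -iterSr.
Qed.

Lemma op_evalX v : op_eval v 'X = D v.
Proof. by rewrite -['X]mul1r op_evalMX op_eval1. Qed.

Lemma op_eval_endo v Q : op_eval (D v) Q = D (op_eval v Q).
Proof.
by rewrite linear_sum; apply: eq_bigr => k _; rewrite linearZ -iterSr.
Qed.

Lemma op_evalM v Q R : op_eval v (Q * R) = op_eval (op_eval v R) Q.
Proof.
elim/poly_ind: Q v => [|Q c IHQ] v; first by rewrite mul0r !linear0.
rewrite mulrDl mulrAC !linearD /= !op_evalMX IHQ op_eval_endo.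
by rewrite mul_polyC linearZ /= op_evalC.
Qed.

Lemma op_evalMl v Q R : op_eval v (Q * R) = op_eval (op_eval v Q) R.
Proof. by rewrite mulrC op_evalM. Qed.

Lemma iter_shift_op a n v :
  iter n (shift_op D a) v = op_eval v (('X + a%:P) ^+ n).
Proof.
elim: n => [|n IHn] /=; first by rewrite op_eval1.
by rewrite exprS op_evalM IHn linearD /= op_evalX op_evalC.
Qed.

Lemma op_eval_big_comp (I : Type) (r : seq I) (P : pred I)
    (g : I -> V -> V) (Q : I -> {poly F}) :
  (forall i, g i =1 op_eval^~ (Q i)) ->
  \big[comp/idfun]_(i <- r | P i) g i =1 op_eval^~ (\prod_(i <- r | P i) Q i).
Proof.
move=> gQ; elim/big_rec2: _ => [v|i R h _ hR v] /=; first by rewrite op_eval1.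
by rewrite gQ hR op_evalM.
Qed.

End PolynomialAction.

(** * A Bezout identity for pairwise coprime polynomials *)

Section Bezout.

Variables (F : fieldType) (I : finType).
Implicit Types (T N : I -> {poly F}) (Q : {poly F}).

Lemma prod_dvdp_coprime T Q :
    (forall i j, i != j -> coprimep (T i) (T j)) ->
  (forall i, T i %| Q) -> \prod_i T i %| Q.
Proof.
move=> coT TQ; elim: (index_enum I) (index_enum_uniq I) => [|i r IHr] /=.
  by rewrite big_nil dvd1p.
case/andP=> ir /IHr rQ; rewrite big_cons Gauss_dvdp ?TQ // coprimep_sym.
rewrite big_seq; elim/big_rec: _ => [|j R jr coR]; first exact: coprime1p.
by rewrite coprimepMl coR andbT coT //; apply: contraNneq ir => <-.
Qed.

(** The sum is 1 modulo each [T k], hence modulo the product of all of them,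
    whose degree exceeds that of the sum.  The index [i0] excludes the empty
    family, for which the sum is 0. *)
Lemma bezout_coprime_family T N (i0 : I) :
    (forall i j, i != j -> coprimep (T i) (T j)) ->
    (forall i, 1 < size (T i))%N ->
    (forall i, size (N i) < size (T i))%N ->
    (forall i, T i %| N i * \prod_(j | j != i) T j - 1) ->
  \sum_i N i * \prod_(j | j != i) T j = 1.
Proof.
move=> coT T_gt1 ltNT NT1.
have T_neq0 i : T i != 0 by rewrite -size_poly_gt0 ltnW.
have R_neq0 i : \prod_(j | j != i) T j != 0 by apply/prodf_neq0.
have sizeT i : size (\prod_j T j) =
    (size (T i) + size (\prod_(j | j != i) T j)%R).-1.
  by rewrite (bigD1 i) //= size_mul.
have R_gt0 i : (0 < size (\prod_(j | j != i) T j)%R)%N by rewrite size_poly_gt0.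
have TE : \prod_i T i %| \sum_i N i * \prod_(j | j != i) T j - 1.
  apply: prod_dvdp_coprime => // k.
  rewrite (bigD1 k) //= addrAC dvdp_addr //.
  elim/big_ind: _ => [|A B TA TB|i neq_ik]; first exact: dvdp0.
    by rewrite dvdp_addr.
  by rewrite dvdp_mull // (bigD1 k) 1?eq_sym // dvdp_mulr.
have ltE : (size (\sum_i N i * \prod_(j | j != i) T j - 1)%R
            < size (\prod_i T i)%R)%N.
  rewrite (leq_ltn_trans (size_polyD _ _)) // gtn_max size_polyN size_poly1.
  apply/andP; split; last first.
    rewrite (sizeT i0) -subn1 ltn_subRL.
    exact: leq_add (T_gt1 i0) (R_gt0 i0).
  rewrite (leq_ltn_trans (size_sum _ _ _)) //.
  have P_gt0 : (0 < size (\prod_j T j)%R)%N.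
    by rewrite size_poly_gt0; apply/prodf_neq0.
  rewrite -(prednK P_gt0) ltnS; apply/bigmax_leqP => i _.
  rewrite (leq_trans (size_polyMleq _ _)) // (sizeT i).
  have lt_i : (size (N i) + size (\prod_(j | j != i) T j)%R <
      size (T i) + size (\prod_(j | j != i) T j)%R)%N.
    by rewrite ltn_add2r.
  by rewrite -!subn1 leq_sub2r // subn1 -ltnS (ltn_predK lt_i).
apply/eqP; rewrite -subr_eq0; apply: contraTT ltE => E_neq0.
by rewrite -leqNgt dvdp_leq.
Qed.

End Bezout.

(** * The normalised inverses of the cofactors *)

Section Cofactors.

Variables (F : fieldType) (l : nat) (lam : 'I_l.+1 -> F) (p : 'I_l.+1 -> nat).
Implicit Types (a : F) (A B Q T : {poly F}).

Definition factor_poly (i : 'I_l.+1) : {poly F} := ('X + (lam i)%:P) ^+ p i.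

Definition cofactor_poly (i : 'I_l.+1) : {poly F} :=
  \prod_(j < l.+1 | j != i) factor_poly j.

Definition normalised_poly a n Q : {poly F} :=
  \sum_(q < n) shifted_coef a Q q *: ('X + a%:P) ^+ q.

(** Truncation in powers of ['X + a] is ordinary truncation conjugated by the
    translation ['X |-> 'X + a]. *)
Lemma normalised_polyE a n Q :
  normalised_poly a n Q = take_poly n (Q \Po ('X - a%:P)) \Po ('X + a%:P).
Proof.
rewrite /take_poly poly_def raddf_sum; apply: eq_bigr => q _ /=.
by rewrite comp_polyZ comp_Xn_poly.
Qed.

Lemma size_normalised_poly a n Q : (size (normalised_poly a n Q) <= n)%N.
Proof.
by rewrite normalised_polyE size_comp_poly2 ?size_XaddC ?size_take_poly.
Qed.

Lemma normalised_poly_mod a n Q :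
  ('X + a%:P) ^+ n %| normalised_poly a n Q - Q.
Proof.
have {2}-> : Q = (Q \Po ('X - a%:P)) \Po ('X + a%:P).
  by have := comp_polyXaddC_K Q (- a); rewrite polyCN opprK.
rewrite normalised_polyE -comp_polyB -comp_Xn_poly dvdp_comp_poly //.
set R := Q \Po _.
by rewrite -{2}(poly_take_drop n R) opprD addrA subrr add0r dvdpNr dvdp_mull.
Qed.

Lemma dvdp_sub1M T A B : T %| A - 1 -> T %| B - 1 -> T %| A * B - 1.
Proof.
move=> TA TB; have -> : A * B - 1 = A * (B - 1) + (A - 1).
  by rewrite mulrBr mulr1 addrA subrK.
by rewrite dvdp_addr // dvdp_mull.
Qed.

Lemma dvdp_sub1X T A n : T %| A - 1 -> T %| A ^+ n - 1.
Proof. by move=> TA; rewrite subrX1 dvdp_mulr. Qed.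

(** With [c = lam i - lam j] and [y = ('X + lam i) / c] one has
    ['X + lam j = c (y - 1)], and [inv_symbol i j] is [- c^-1] times the
    geometric sum of [y], so their product is [1 - y ^ p i]. *)
Lemma inv_symbol_mod i j :
    lam i != lam j ->
  factor_poly i %| inv_symbol lam p i j * ('X + (lam j)%:P) - 1.
Proof.
rewrite -subr_eq0 /factor_poly /inv_symbol -[lam j - lam i]opprB.
rewrite invrN => c_neq0.
set c := lam i - lam j in c_neq0 *; set y := c^-1 *: ('X + (lam i)%:P).
have -> : 'X + (lam j)%:P = c *: (y - 1).
  rewrite scalerBr scalerA divff // scale1r -mul_polyC mulr1 polyCB opprB.
  by rewrite addrACA subrr addr0.
under eq_bigr do rewrite -exprVn -exprZn.
rewrite scaleNr mulNr -scalerAl -scalerAr scalerA mulVf // scale1r mulrC.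
rewrite -subrX1 opprB addrAC subrr add0r dvdpNr exprZn.
by rewrite -mul_polyC dvdp_mull.
Qed.

Definition cofactor_inv (i : 'I_l.+1) : {poly F} :=
  normalised_poly (lam i) (p i)
    (\prod_(j < l.+1 | j != i) inv_symbol lam p i j ^+ p j).

Hypotheses (lam_inj : injective lam) (p_gt0 : forall i, (0 < p i)%N).

Lemma cofactor_inv_mod i :
  factor_poly i %| cofactor_inv i * cofactor_poly i - 1.
Proof.
rewrite /cofactor_inv; set Q := \prod_(j < _ | _) _.
have QR1 : factor_poly i %| Q * cofactor_poly i - 1.
  rewrite -big_split /=; elim/big_ind: _ => [|A B|j neq_ji].
  - by rewrite subrr dvdp0.
  - exact: dvdp_sub1M.
  rewrite -exprMn dvdp_sub1X // inv_symbol_mod //.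
  by rewrite (inj_eq lam_inj) eq_sym.
rewrite -(subrK Q (normalised_poly _ _ _)) mulrDl -addrA dvdp_addr //.
by rewrite dvdp_mulr // normalised_poly_mod.
Qed.

Lemma size_factor_poly i : size (factor_poly i) = (p i).+1.
Proof. by rewrite /factor_poly -[lam i]opprK polyCN size_exp_XsubC. Qed.

Lemma factor_poly_coprime i j :
  i != j -> coprimep (factor_poly i) (factor_poly j).
Proof.
move=> neq_ij; apply/coprimep_expl/coprimep_expr.
rewrite -[lam i]opprK -[lam j]opprK !(polyCN (- _)) coprimep_XsubC2 //.
by rewrite opprK addrC subr_eq0 (inj_eq lam_inj).
Qed.

Lemma cofactor_bezout : \sum_i cofactor_inv i * cofactor_poly i = 1.
Proof.
apply: (bezout_coprime_family ord0).
- exact: factor_poly_coprime.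
- by move=> i; rewrite size_factor_poly ltnS.
- by move=> i; rewrite size_factor_poly ltnS size_normalised_poly.
- exact: cofactor_inv_mod.
Qed.

End Cofactors.

(** * The operators of the decomposition as polynomials in [D] *)

Section Operators.

Variables (F : fieldType) (V : lmodType F) (D : {linear V -> V}).
Variables (l : nat) (lam : 'I_l.+1 -> F) (p : 'I_l.+1 -> nat).

Lemma factor_opE i u :
  factor_op D lam p i u = op_eval D u (factor_poly lam p i).
Proof. exact: iter_shift_op. Qed.

Lemma P_opE u : P_op D lam p u = op_eval D u (\prod_i factor_poly lam p i).
Proof. by apply: op_eval_big_comp => i v; exact: factor_opE. Qed.

Lemma cofactor_opE i u :
  cofactor_op D lam p i u = op_eval D u (cofactor_poly lam p i).
Proof. by apply: op_eval_big_comp => j v; exact: factor_opE. Qed.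

Lemma B_mapE u :
  B_map D lam p u = \sum_i op_eval D (u i) (cofactor_inv lam p i).
Proof.
apply: eq_bigr => i _; rewrite linear_sum; apply: eq_bigr => q _ /=.
by rewrite linearZ iter_shift_op.
Qed.

Lemma sol_prodP f (u : {ffun 'I_l.+1 -> V}) :
  reflect (forall i, op_eval D (u i) (factor_poly lam p i) = f)
          (u \in sol_prod D lam p f).
Proof.
by apply: (iffP forallP) => uf i; move: (uf i); rewrite inE factor_opE => /eqP.
Qed.

(** Both sides are the product of the remaining factors applied to [f]. *)
Lemma cofactor_swap f (u : {ffun 'I_l.+1 -> V}) i k :
    u \in sol_prod D lam p f ->
  op_eval D (u i) (cofactor_poly lam p k) =
    op_eval D (u k) (cofactor_poly lam p i).
Proof.
move=> /sol_prodP uf; have [-> //|neq_ik] := eqVneq i k.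
rewrite /cofactor_poly (bigD1 i) //= [in RHS](bigD1 k) 1?eq_sym //=.
rewrite !op_evalMl !uf; congr (op_eval _ _ _).
by apply: eq_bigl => j; rewrite andbC.
Qed.

End Operators.

Theorem theorem3p5 (F : fieldType) (V : lmodType F) (D : {linear V -> V})
    (l : nat) (lam : 'I_l.+1 -> F) (p : 'I_l.+1 -> nat) (f : V)
    (lam_inj : injective lam) (p_gt0 : forall i, (0 < p i)%N) :
  [/\ forall u, u \in sol_P D lam p f -> F_map D lam p u \in sol_prod D lam p f,
      forall u, u \in sol_prod D lam p f -> B_map D lam p u \in sol_P D lam p f,
      {in sol_P D lam p f, cancel (F_map D lam p) (B_map D lam p)}
    & {in sol_prod D lam p f, cancel (B_map D lam p) (F_map D lam p)}].
Proof.
have bezout v : \sum_i op_eval D v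
    (cofactor_inv lam p i * cofactor_poly lam p i) = v.
  by rewrite -linear_sum cofactor_bezout //= op_eval1.
have prodE i : \prod_j factor_poly lam p j =
    cofactor_poly lam p i * factor_poly lam p i.
  by rewrite (bigD1 i) //= mulrC.
split=> u.
- rewrite inE P_opE => /eqP uf; apply/sol_prodP => i.
  by rewrite ffunE cofactor_opE -op_evalMl -prodE.
- move=> /sol_prodP uf; rewrite inE P_opE B_mapE op_eval_sumv; apply/eqP.
  rewrite -[RHS]bezout; apply: eq_bigr => i _.
  by rewrite -op_evalMl (prodE i) mulrA op_evalM uf.
- move=> _; rewrite B_mapE -[RHS]bezout; apply: eq_bigr => i _.
  by rewrite ffunE cofactor_opE op_evalM.
- move=> uf; apply/ffunP => k; rewrite ffunE cofactor_opE B_mapE op_eval_sumv.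
  rewrite -[RHS]bezout; apply: eq_bigr => i _.
  by rewrite -op_evalMl op_evalM (cofactor_swap i k uf) -op_evalM.
Qed.
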